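(* Let $n\ge 2$ and let $f\in L^1(\mathbb{R}^n)$ be real-valued with $\int_{\mathbb{R}^n}(1+|x|)^2|f(x)|\,dx<\infty$ and $\int_{\mathbb{R}^n} f(x)\,dx\neq 0$. Let $x^*=(x_1^*,\dots,x_n^* )\in\mathbb{R}^n$ be defined by $$x_i^*\int_{\mathbb{R}^n} f(x)\,dx=\int_{\mathbb{R}^n}x_i f(x)\,dx,\qquad i=1,\dots,n.$$ Assume that there exists a constant $c_{\mathbf 0}\in\mathbb{R}$ such that $$\frac12\int_{\mathbb{R}^n}x_ix_jf(x)\,dx-\frac12\Big(\int_{\mathbb{R}^n}f(x)\,dx\Big)x_i^*x_j^*=c_{\mathbf 0}\,\delta_{ij}\qquad\text{for all } i,j=1,\dots,n,$$ and let $t^*\in\mathbb{R}$ be given by $c_{\mathbf 0}+t^*\int_{\mathbb{R}^n}f(x)\,dx=0$. Let $u(x,t)=\int_{\mathbb{R}^n}G_t(x-y)f(y)\,dy$ be the solution of $u_t=\Delta u$ in $\mathbb{R}^n\times(0,\infty)$ with initial data $u(x,0)=f(x)$. Then for every $1\le p\le\infty$, $$\lim_{t\to\infty}t^{1+\frac n2(1-\frac1p)}\big\|u(\cdot,t)-\hat G^{(0)}_t(\cdot;x^*,t^* )\big\|_{L^p(\mathbb{R}^n)}=0.$$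
   Context: $G_t(x)=(4\pi t)^{-n/2}\exp(-|x|^2/(4t))$ for $t>0$, $x\in\mathbb{R}^n$, is the heat kernel. For $x^*\in\mathbb{R}^n$, $t^*\in\mathbb{R}$, the 0-th order modified heat kernel is $$\hat G_t^{(0)}(x;x^*,t^* )=\Big(\int_{\mathbb{R}^n}f(y)\,dy\Big)\,G_{t-t^*}(x-x^* ),\qquad t>\max\{t^*,0\},\ x\in\mathbb{R}^n.$$ $\delta_{ij}$ is the Kronecker delta. For $p=\infty$, $1/p=0$. *)

(* Defs.v *)
From HB Require Import structures.
From mathcomp Require Import all_boot all_order all_algebra.
From mathcomp Require Import all_classical all_reals all_analysis.

Set Implicit Arguments.
Unset Strict Implicit.
Unset Printing Implicit Defensive.

Import Order.TTheory GRing.Theory Num.Theory.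
Import numFieldNormedType.Exports.

Local Open Scope classical_set_scope.
Local Open Scope ring_scope.

(* R^n as n-tuples with the product of the Borel sigma-algebras;
   [measurableTypeR R] is [R] itself, carrying the sigma-algebra on which
   [lebesgue_measure] is declared to be a measure. *)
Notation Rn R n := (n.-tuple (measurableTypeR R)).

Section lebesgue_measure_n.
Context {R : realType}.

Definition cons_pair (n : nat) (x : measurableTypeR R * Rn R n) : Rn R n.+1 :=
  [tuple of x.1 :: x.2].

(* The n-fold product of the Lebesgue measure on R, transported along
   R * R^n ~ R^(n+1); R^0 is a point of mass 1. *)
Fixpoint lebesgue_measure_n (n : nat) : set (Rn R n) -> \bar R :=
  match n with
  | 0 => \d_ ([tuple] : Rn R 0)
  | m.+1 => pushforward (lebesgue_measure \x @lebesgue_measure_n m)%E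
                        (@cons_pair m)
  end.

Lemma measurable_cons_pair n : measurable_fun [set: _] (@cons_pair n).
Proof. exact: measurable_cons. Qed.

End lebesgue_measure_n.

Section push_cons.
Context {R : realType} (n : nat).
Variable m : {sigma_finite_measure set (Rn R n) -> \bar R}.

Let prodm : {measure set (measurableTypeR R * Rn R n)%type -> \bar R} :=
  (lebesgue_measure \x m)%E.

Definition push_cons := pushforward prodm (@cons_pair R n).

Let push_cons0 : push_cons set0 = 0%E.
Proof. by rewrite /push_cons /pushforward preimage_set0 measure0. Qed.

Let push_cons_ge0 A : (0 <= push_cons A)%E.
Proof. exact: (measure_ge0 prodm). Qed.

Let push_cons_sigma_additive : semi_sigma_additive push_cons.
Proof.
have mc := @measurable_cons_pair R n.
move=> F mF tF mUF; rewrite /push_cons /pushforward preimage_bigcup.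
apply: (@measure_semi_sigma_additive _ _ _ prodm).
- by move=> k; rewrite -[X in measurable X]setTI; exact: mc.
- apply/trivIsetP => /= i j _ _ ij; rewrite -preimage_setI.
  by move/trivIsetP : tF => /(_ _ _ _ _ ij) ->//; rewrite preimage_set0.
- by rewrite -preimage_bigcup -[X in measurable X]setTI; exact: mc.
Qed.

HB.instance Definition _ := isMeasure.Build _ _ _ push_cons
  push_cons0 push_cons_ge0 push_cons_sigma_additive.

Let push_cons_sigma_finite : sigma_finite setT push_cons.
Proof.
have /sigma_finiteP[F [TF ndF Foo]] := sigma_finiteT (@lebesgue_measure R).
have /sigma_finiteP[G [TG ndG Goo]] := sigma_finiteT m.
pose g (x : Rn R n.+1) := (thead x, [tuple of behead x]).
have mg : measurable_fun [set: _] g.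
  by apply: measurable_fun_pair; [exact: measurable_tnth|exact: measurable_behead].
have gK x : g (cons_pair x) = x.
  by case: x => a b; congr pair; apply/val_inj.
exists (fun k => g @^-1` (F k `*` G k)).
  rewrite -preimage_bigcup; apply/esym/seteqP; split => // x _.
  have [k _ Fk] : (\bigcup_k F k) (g x).1 by rewrite -TF.
  have [l _ Gl] : (\bigcup_k G k) (g x).2 by rewrite -TG.
  exists (maxn k l) => //; split.
  - by move: Fk; exact/subsetPset/ndF/leq_maxl.
  - by move: Gl; exact/subsetPset/ndG/leq_maxr.
move=> k; have [mF Fk] := Foo k; have [mG Gk] := Goo k; split.
  by rewrite -[X in measurable X]setTI; apply: mg => //; exact: measurableX.
rewrite /push_cons /pushforward -comp_preimage (_ : g \o _ = id); last exact/funext.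
by rewrite preimage_id /prodm /= product_measure1E// lte_mul_pinfty// ge0_fin_numE.
Qed.

HB.instance Definition _ := Measure_isSigmaFinite.Build _ _ _ push_cons
  push_cons_sigma_finite.

End push_cons.

Section lebesgue_measure_n_measure.
Context {R : realType} (n : nat).
Notation mu := (@lebesgue_measure_n R n).

Let mu_measure :
  exists m : {sigma_finite_measure set (Rn R n) -> \bar R}, mu = m.
Proof.
elim: n => [|k [m mE]]; first by exists (\d_ ([tuple] : Rn R 0)).
by exists (push_cons m); rewrite /push_cons /= mE.
Qed.

Let mu0 : mu set0 = 0%E.
Proof. by have [m ->] := mu_measure; exact: measure0. Qed.

Let mu_ge0 A : (0 <= mu A)%E.
Proof. by have [m ->] := mu_measure; exact: measure_ge0. Qed.

Let mu_sigma_additive : semi_sigma_additive mu.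
Proof. by have [m ->] := mu_measure; exact: measure_semi_sigma_additive. Qed.

HB.instance Definition _ := isMeasure.Build _ _ _ mu
  mu0 mu_ge0 mu_sigma_additive.

Let mu_sigma_finite : sigma_finite setT mu.
Proof. by have [m ->] := mu_measure; exact: sigma_finiteT. Qed.

HB.instance Definition _ := Measure_isSigmaFinite.Build _ _ _ mu
  mu_sigma_finite.

End lebesgue_measure_n_measure.

Lemma lebesgue_measure_n_box (R : realType) (n : nat)
    (A : 'I_n -> set (measurableTypeR R)) :
  (forall i, measurable (A i)) ->
  lebesgue_measure_n [set x : Rn R n | forall i, A i (tnth x i)] =
  (\prod_(i < n) lebesgue_measure (A i))%E.
Proof.
elim: n A => [|n IH] A mA.
  rewrite big_ord0 /= diracE mem_set//; by case.
rewrite big_ord_recl -IH//.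
rewrite -product_measure1E//; last first.
  have -> : [set x : Rn R n | forall i, A (lift ord0 i) (tnth x i)] =
      \bigcap_(i in [set: 'I_n]) ((fun x => tnth x i) @^-1` A (lift ord0 i)).
    by apply/seteqP; split => [x h i _|x h i]; exact: h.
  apply: fin_bigcap_measurable => // i _.
  rewrite -[X in measurable X]setTI.
  exact: (measurable_tnth (T := measurableTypeR R) i).
rewrite /= /pushforward; congr product_measure1.
apply/seteqP; split => -[a b] /=.
- move=> h; split; first exact: (h ord0).
  by move=> i; have := h (lift ord0 i); rewrite tnthS.
- move=> [ha hb] i; case: (unliftP ord0 i) => [j ->|->//].
  by rewrite tnthS; exact: hb.
Qed.

Section heat.
Context {R : realType} {n : nat}.
Local Notation mu := (@lebesgue_measure_n R n).

Definition tsub (x y : Rn R n) : Rn R n :=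
  [tuple (tnth x i - tnth y i : R) | i < n].

Definition enorm (x : Rn R n) : R :=
  Num.sqrt (\sum_(i < n) (tnth x i : R) ^+ 2).

(* Only meaningful for t > 0. *)
Definition heat_kernel (t : R) (x : Rn R n) : R :=
  (4 * pi * t) `^ (- (n%:R / 2)) * expR (- (enorm x ^+ 2 / (4 * t))).

Definition heat_solution (f : Rn R n -> R) (x : Rn R n) (t : R) : R :=
  \int[mu]_y (heat_kernel t (tsub x y) * f y).

(* Only meaningful for t > max(ts, 0). *)
Definition modified_heat_kernel0 (f : Rn R n -> R) (xs : Rn R n) (ts t : R)
    (x : Rn R n) : R :=
  (\int[mu]_y f y) * heat_kernel (t - ts) (tsub x xs).

End heat.

(* Main.v *)
(** Put [w = x - xs], [z = y - xs], [a = w / sqrt (4 t)] and [b = z / sqrt (4 t)].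
    Taylor's formula for the kernel [G_t(x - y)], proportional to
    [exp (- |a - b|^2)], at [b = 0] has second order polynomial
    [exp (- |a|^2) (1 + 2 a.b - |b|^2 + 2 (a.b)^2)] and a remainder at most
    [C |b|^2 min(1, |b|) (exp (- |a - b|^2 / 2) + exp (- |a|^2 / 2))].
    Integrated against [f], the polynomial gives
    [M G_t(w) + c0 (Laplacian G_t)(w)] by the conditions on the first and second
    moments, and since [c0 = - ts M] this is the first order expansion in time
    of [M G_(t - ts)(w)], up to [O(t^-2)].  Hence the error is pointwise at most
    [eps(t) t^-1] times averages of Gaussians of width [sqrt t], where [eps(t)]
    tends to 0 by dominated convergence.  This bounds its sup norm by
    [eps(t) t^(-1 - n/2)] and its L^1 norm by [eps(t) t^-1], and
    [|g|_p <= |g|_oo^(1 - 1/p) |g|_1^(1/p)] does the rest. *)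

Require Import Defs.
From mathcomp Require Import all_boot all_order all_algebra.
From mathcomp Require Import all_classical all_reals all_analysis.
From mathcomp Require Import measurable_realfun ess_sup_inf ring lra.
Import Order.TTheory GRing.Theory Num.Theory.
Import numFieldNormedType.Exports.
Local Open Scope classical_set_scope.
Local Open Scope ring_scope.

(** * Taylor remainders of the exponential and of Gaussians *)

Section exponential_remainders.
Context {R : realType}.
Implicit Types x q a b c : R.

(** Multiplying [1 - x <= expR (- x)] by [expR x] bounds [expR x - 1] above by [x * expR x]; the
    tangent at 0 bounds it below by [x]. *)
Lemma norm_expRB1_le x : `|expR x - 1| <= `|x| * expR `|x|.
Proof.
have h1 := expR_ge1Dx x.
have h2 : expR x - 1 <= x * expR x.
  have := expR_ge1Dx (- x); have := expRxMexpNx_1 x; have := expR_gt0 x.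
  by set u := expR x; set v := expR (- x); nra.
have [x0|x0] := leP 0 x.
  rewrite ger0_norm; first by rewrite ger0_norm.
  by lra.
have e1 : expR x <= 1 by rewrite -expR0 ler_expR ltW.
have e2 : 1 <= expR (- x) by rewrite -expR0 ler_expR; lra.
by rewrite ler0_norm ?(ltr0_norm x0); [nra|lra].
Qed.

Lemma norm_expRB1x_le x : `|expR x - 1 - x| <= `|x| ^+ 2 * expR `|x|.
Proof.
have h0 : 0 <= expR x - 1 - x by have := expR_ge1Dx x; lra.
have h2 : expR x - 1 - x <= x * (expR x - 1).
  have := expR_ge1Dx (- x); have := expRxMexpNx_1 x; have := expR_gt0 x.
  by set u := expR x; set v := expR (- x); nra.
rewrite ger0_norm// (le_trans h2)// (le_trans (ler_norm _))// normrM expr2 -mulrA.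
by rewrite ler_wpM2l// norm_expRB1_le.
Qed.

(** The derivative of this remainder is the preceding remainder, so the mean value theorem between 0
    and [x] raises the order by one. *)
Lemma norm_expRB1xx_le x :
  `|expR x - 1 - x - x ^+ 2 / 2| <= `|x| ^+ 3 * expR `|x|.
Proof.
pose g y : R := expR y - 1 - y - y ^+ 2 / 2.
pose dg y : R := expR y - 1 - y.
have dgE (y : R) : is_derive y 1 g (dg y).
  rewrite /g /dg; apply: is_derive_eq; rewrite /GRing.scale/=.
  by field.
have cg (A : set R) : {within A, continuous g}.
  apply: continuous_subspaceT => y; apply: differentiable_continuous.
  by apply/derivable1_diffP; case: (dgE y).
have g0 : g 0 = 0 by rewrite /g expR0; lra.
have key c : `|c| <= `|x| -> `|dg c * x| <= `|x| ^+ 3 * expR `|x|.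
  move=> cx; rewrite normrM.
  rewrite (_ : `|x| ^+ 3 * _ = (`|x| ^+ 2 * expR `|x|) * `|x|); last by ring.
  rewrite ler_wpM2r// (le_trans (norm_expRB1x_le _))//.
  by rewrite ler_pM ?exprn_ge0 ?expR_ge0 ?ler_expR// lerXn2r ?nnegrE.
have [x0|x0|->] := ltgtP x 0.
- have [c] := MVT x0 (fun y _ => dgE y) (cg _).
  rewrite in_itv/= g0 => /andP[xc c0] gE.
  rewrite -[_ - _ - _ - _]/(g x) (_ : g x = dg c * x); last by lra.
  by apply: key; rewrite !ltr0_norm//; lra.
- have [c] := MVT x0 (fun y _ => dgE y) (cg _).
  rewrite in_itv/= g0 => /andP[xc c0] gE.
  rewrite -[_ - _ - _ - _]/(g x) (_ : g x = dg c * x); last by lra.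
  by apply: key; rewrite !gtr0_norm//; lra.
- by rewrite -[_ - _ - _ - _]/(g 0) g0 !normr0 mulr_ge0// expR_ge0.
Qed.

(** This is the cube of [x / 3 <= expR (x / 3)]. Squaring [x / 8 <= expR (x / 8)] in the same way
    gives [sqr_le_expR], with only [x / 4] in the exponent. *)
Lemma cube_le_expR x : 0 <= x -> x ^+ 3 <= 27 * expR x.
Proof.
move=> x0; have := expR_ge1Dx (x / 3).
have -> : expR x = expR (x / 3) ^+ 3 by rewrite -expRM_natl; congr expR; field.
move=> h; rewrite (_ : 27 = 3 ^+ 3); last by ring.
by rewrite -exprMn lerXn2r ?nnegrE// ?mulr_ge0 ?expR_ge0//; lra.
Qed.

Lemma sqr_le_expR x : 0 <= x -> x ^+ 2 <= 64 * expR (x / 4).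
Proof.
move=> x0; have := expR_ge1Dx (x / 8).
have -> : expR (x / 4) = expR (x / 8) ^+ 2 by rewrite -expRM_natl; congr expR; field.
move=> h; rewrite (_ : 64 = 8 ^+ 2); last by ring.
by rewrite -exprMn lerXn2r ?nnegrE// ?mulr_ge0 ?expR_ge0//; lra.
Qed.

(* The second order Taylor remainder of b |-> exp(-|a-b|^2) at b = 0, with
   A = |a|^2, B = |b|^2 and c = a.b. *)
Definition gauss_remainder (A B c : R) : R :=
  expR (- (A - 2 * c + B)) - expR (- A) * (1 + 2 * c - B + 2 * c ^+ 2).

(** The factor [Num.min 1 (Num.sqrt B)] joins two regimes: a cubic Taylor bound for |b| <= 1, and
    for |b| > 1 a crude quadratic one, which second moments can absorb. Giving up half of the
    exponents pays for the powers of |a|. *)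
Lemma norm_gauss_remainder_le A B c : 0 <= A -> 0 <= B -> c ^+ 2 <= A * B ->
  `|gauss_remainder A B c| <=
  54 * expR 10 * (B * Num.min 1 (Num.sqrt B)) *
  (expR (- (A - 2 * c + B) / 2) + expR (- A / 2)).
Proof.
move=> A0 B0 cAB; rewrite /gauss_remainder.
set al := Num.sqrt A; set be := Num.sqrt B.
have al0 : 0 <= al := sqrtr_ge0 _.
have be0 : 0 <= be := sqrtr_ge0 _.
have AE : A = al ^+ 2 by rewrite sqr_sqrtr.
have BE : B = be ^+ 2 by rewrite sqr_sqrtr.
have cle : `|c| <= al * be.
  rewrite -(@ler_pXn2r _ 2) ?nnegrE ?mulr_ge0// real_normK ?num_real//.
  by rewrite exprMn -AE -BE.
have D0 : 0 <= A - 2 * c + B.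
  move: cle; rewrite ler_norml => /andP[]; rewrite AE BE.
  by have := sqr_ge0 (al - be); nra.
set D := A - 2 * c + B in D0 *.
have E10 : 1 <= expR 10 :> R by rewrite -expR0 ler_expR.
have eD0 : 0 < expR (- D / 2) := expR_gt0 _.
have eA0 : 0 < expR (- A / 2) := expR_gt0 _.
have [be1|be1] := leP be 1.
- set q := 2 * c - B.
  have DE : expR (- D) = expR (- A) * expR q.
    by rewrite -expRD; congr expR; rewrite /D /q; ring.
  have qle : `|q| <= be * (2 * al + 1).
    by move: cle; rewrite !ler_norml => /andP[? ?]; apply/andP; rewrite /q BE; split; nra.
  have qle' : `|q| <= 2 * al + 1 by apply: le_trans qle _; nra.
  (* Expanding [q ^+ 2 / 2] produces [2 * c ^+ 2] and the terms [- 2 * c * B + B ^+ 2 / 2], of order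
     at least three in b. *)
  have rE : expR (- D) - expR (- A) * (1 + 2 * c - B + 2 * c ^+ 2) =
      expR (- A) * ((expR q - 1 - q - q ^+ 2 / 2) + (- 2 * c * B + B ^+ 2 / 2)).
    by rewrite DE /q; field.
  have h1 : `|expR q - 1 - q - q ^+ 2 / 2| <=
      be ^+ 3 * (27 * expR (2 * (2 * al + 1))).
    apply: le_trans (norm_expRB1xx_le _) _.
    apply: (@le_trans _ _ ((be * (2 * al + 1)) ^+ 3 * expR (2 * al + 1))).
      by rewrite ler_pM ?exprn_ge0 ?expR_ge0 ?ler_expR// lerXn2r ?nnegrE// mulr_ge0//; lra.
    rewrite exprMn -mulrA ler_wpM2l ?exprn_ge0//.
    rewrite (_ : 2 * (2 * al + 1) = (2 * al + 1) + (2 * al + 1)); last by ring.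
    by rewrite (expRD (2 * al + 1)) mulrA ler_wpM2r ?expR_ge0// cube_le_expR//; lra.
  have h2 : `|- 2 * c * B + B ^+ 2 / 2| <= be ^+ 3 * (2 * al + 1).
    have b3 : 0 <= be ^+ 3 by rewrite exprn_ge0.
    have b4 : be ^+ 4 <= be ^+ 3 by rewrite exprS ler_piMl.
    have : `|2 * c * B| <= 2 * al * be ^+ 3.
      rewrite BE normrM (ger0_norm (exprn_ge0 2 be0)) normrM (ger0_norm (ler0n _ 2)).
      rewrite (_ : 2 * al * be ^+ 3 = 2 * (al * be) * be ^+ 2); last by ring.
      by rewrite ler_wpM2r ?exprn_ge0// ler_wpM2l.
    rewrite !ler_norml => /andP[? ?].
    have -> : B ^+ 2 = be ^+ 4 by rewrite BE -exprM.
    have b40 : 0 <= be ^+ 4 by rewrite exprn_ge0.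
    by apply/andP; split; nra.
  have h3 : 2 * al + 1 <= expR (2 * (2 * al + 1)).
    by apply: le_trans (expR_ge1Dx _); lra.
  rewrite rE normrM ger0_norm ?expR_ge0//.
  apply: (@le_trans _ _ (expR (- A) * (be ^+ 3 * (54 * expR (2 * (2 * al + 1)))))).
    rewrite ler_wpM2l ?expR_ge0// (le_trans (ler_normD _ _))//.
    have : be ^+ 3 * (2 * al + 1) <= be ^+ 3 * expR (2 * (2 * al + 1)).
      by rewrite ler_wpM2l// exprn_ge0.
    have : 0 <= be ^+ 3 * expR (2 * (2 * al + 1)) by rewrite mulr_ge0 ?exprn_ge0 ?expR_ge0.
    by move: h1 h2; set X := expR (2 * _); lra.
  (* The constant 10 comes from completing the square: [10 + al ^+ 2 / 2 - (4 * al + 2)] equals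
     [(al - 4) ^+ 2 / 2]. *)
  have h4 : expR (- A) * expR (2 * (2 * al + 1)) <= expR 10 * expR (- A / 2).
    by rewrite -!expRD ler_expR AE; have := sqr_ge0 (al - 4); nra.
  have b3E : B * be = be ^+ 3 by rewrite BE; ring.
  have b3 : 0 <= be ^+ 3 by rewrite exprn_ge0.
  rewrite b3E.
  apply: (@le_trans _ _ (54 * expR 10 * be ^+ 3 * expR (- A / 2))).
    rewrite (_ : expR (- A) * _ = 54 * be ^+ 3 * (expR (- A) * expR (2 * (2 * al + 1)))); last by ring.
    rewrite (_ : 54 * expR 10 * be ^+ 3 * _ = 54 * be ^+ 3 * (expR 10 * expR (- A / 2))); last by ring.
    by rewrite ler_wpM2l// mulr_ge0.
  by rewrite ler_wpM2l ?mulr_ge0 ?expR_ge0//; lra.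
(* Here |b| > 1: the kernel and the polynomial are each bounded by a multiple of [B], with no
   cancellation. *)
- rewrite mulr1.
  have B1 : 1 <= B by rewrite BE; nra.
  have h1 : expR (- D) <= B * expR (- D / 2).
    apply: (@le_trans _ _ (expR (- D / 2))); first by rewrite ler_expR; lra.
    by rewrite ler_peMl ?expR_ge0.
  have h2 : `|1 + 2 * c - B + 2 * c ^+ 2| <= B * (2 * (1 + al + al ^+ 2)).
    have bB : be <= B by rewrite BE; nra.
    have h : `|c| <= al * B by rewrite (le_trans cle)// ler_wpM2l.
    have c2 : c ^+ 2 <= al ^+ 2 * B by rewrite -AE.
    have := sqr_ge0 c.
    by move: h; rewrite !ler_norml => /andP[? ?] ?; apply/andP; split; nra.
  have h3 : expR (- A) * (2 * (1 + al + al ^+ 2)) <= 8 * expR 10 * expR (- A / 2).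
    have h31 : 1 + al + al ^+ 2 <= 4 * expR al.
      have := expR_ge1Dx (al / 2).
      have -> : expR al = expR (al / 2) ^+ 2 by rewrite -expRM_natl; congr expR; field.
      by nra.
    have h32 : expR (- A) * expR al <= expR 10 * expR (- A / 2).
      by rewrite -!expRD ler_expR AE; have := sqr_ge0 (al - 1); nra.
    have := expR_gt0 (- A); nra.
  apply: le_trans (ler_normB _ _) _.
  rewrite normrM !(ger0_norm (expR_ge0 _)).
  have h4 : expR (- A) * `|1 + 2 * c - B + 2 * c ^+ 2| <= 8 * expR 10 * (B * expR (- A / 2)).
    apply: (@le_trans _ _ (expR (- A) * (B * (2 * (1 + al + al ^+ 2))))).
      by rewrite ler_wpM2l ?expR_ge0.
    rewrite mulrCA (_ : 8 * _ * _ = B * (8 * expR 10 * expR (- A / 2))); last by ring.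
    by rewrite ler_wpM2l.
  have : 0 <= B * expR (- A / 2) by rewrite mulr_ge0 ?expR_ge0.
  have : 0 <= B * expR (- D / 2) by rewrite mulr_ge0 ?expR_ge0.
  rewrite -(mulrA (54 * expR 10) B) mulrDr; move: h1 h4 E10.
  set u := B * expR (- A / 2); set v := B * expR (- D / 2).
  set e := expR 10; set X := expR (- D); set Y := _ * `|_| => h1 h4 E10 v0 u0.
  have : v <= e * v by rewrite ler_peMl.
  have : 0 <= e * u by rewrite mulr_ge0 ?expR_ge0.
  by lra.
Qed.

(* With s = tau / (1 - tau), the quotient of the two kernels is
   exp (N ln (1 + s) - A s), and tau <= ln (1 + s) <= s. *)
Lemma norm_heat_time_remainder_le (N A tau : R) : 0 <= N -> 0 <= A -> `|tau| <= 16^-1 ->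
  `|expR (- A) * (1 - tau * (A - N)) -
    (1 - tau) `^ (- N) * expR (- (A / (1 - tau)))| <=
  272 * expR (3 / 8 * N) * tau ^+ 2 * expR (- A / 2).
Proof.
move=> N0 A0; rewrite ler_norml => /andP[tau1 tau2].
have t0 : 0 < 1 - tau by lra.
set sg := tau / (1 - tau).
have sgE : sg - tau = tau ^+ 2 / (1 - tau) by rewrite /sg; field; lra.
have ti2 : (1 - tau)^-1 <= 2 by rewrite invf_ple ?posrE//; lra.
have ti0 : 0 < (1 - tau)^-1 by rewrite invr_gt0.
have sgt0 : 0 <= sg - tau by rewrite sgE divr_ge0 ?sqr_ge0// ltW.
have sgt : sg - tau <= 2 * tau ^+ 2 by rewrite sgE mulrC ler_wpM2r// sqr_ge0.
have sg1 : (1 - tau)^-1 = 1 + sg by rewrite /sg; field; lra.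
set l := - ln (1 - tau).
have lge : tau <= l by rewrite /l; have := @le_ln1Dx _ (- tau); lra.
have lle : l <= sg.
  have -> : l = ln (1 + sg) by rewrite -sg1 lnV ?posrE.
  by apply: le_ln1Dx; lra.
have nsg : `|sg| <= 2 * `|tau|.
  by rewrite normrM mulrC ler_wpM2r// gtr0_norm.
have nl : `|l| <= 2 * `|tau|.
  move: nsg; rewrite !ler_norml => /andP[? ?]; apply/andP; split; last by lra.
  by have := ler_norm (- tau); rewrite normrN; have := normr_ge0 tau; lra.
set v := N * l - A * sg.
set y := N + A.
have y0 : 0 <= y by rewrite addr_ge0.
have vle : `|v| <= 2 * `|tau| * y.
  rewrite (le_trans (ler_normB _ _))// (normrM N) (normrM A) (ger0_norm N0) (ger0_norm A0) /y.
  by rewrite mulrDr; apply: lerD; rewrite mulrC ler_wpM2r.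
have tau16 : `|tau| <= 16^-1 by rewrite ler_norml tau1 tau2.
(* The size of [16^-1] matters here: at most an eighth of [y] enters the exponent. *)
have vle' : `|v| <= y / 8 by nra.
have h1 : `|expR v - 1 - v| <= 256 * (tau ^+ 2 * expR (3 / 8 * y)).
  apply: le_trans (norm_expRB1x_le _) _.
  apply: (@le_trans _ _ ((2 * `|tau| * y) ^+ 2 * expR (y / 8))).
    by rewrite ler_pM ?exprn_ge0 ?expR_ge0 ?ler_expR// lerXn2r ?nnegrE ?mulr_ge0.
  rewrite (_ : (_ * y) ^+ 2 = 4 * `|tau| ^+ 2 * y ^+ 2); last by ring.
  rewrite real_normK ?num_real//.
  apply: (@le_trans _ _ (4 * tau ^+ 2 * (64 * expR (y / 4)) * expR (y / 8))).
    rewrite ler_wpM2r ?expR_ge0//; apply: ler_wpM2l; last exact: sqr_le_expR.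
    by rewrite mulr_ge0 ?sqr_ge0.
  rewrite (_ : 3 / 8 * y = y / 4 + y / 8); last by field.
  by rewrite expRD le_eqVlt; apply/orP; left; apply/eqP; ring.
(* Both [l - tau] and [sg - tau] lie between 0 and [2 * tau ^+ 2]. *)
have h2 : `|v - tau * (N - A)| <= 16 * (tau ^+ 2 * expR (3 / 8 * y)).
  have : y <= 8 * expR (3 / 8 * y) by have := expR_ge1Dx (3 / 8 * y); lra.
  rewrite (_ : v - tau * (N - A) = N * (l - tau) - A * (sg - tau)); last first.
    by rewrite /v; ring.
  have t2 := sqr_ge0 tau.
  move=> ?; apply: (@le_trans _ _ (2 * tau ^+ 2 * y)); last by nra.
  rewrite (le_trans (ler_normB _ _))// !normrM (ger0_norm N0) (ger0_norm A0).
  rewrite (ger0_norm sgt0) ger0_norm; last by lra.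
  by rewrite /y; nra.
have E : (1 - tau) `^ (- N) * expR (- (A / (1 - tau))) = expR (- A) * expR v.
  rewrite /powR gt_eqF// -!expRD; congr expR; rewrite sg1 /v /l; ring.
rewrite E -mulrBr normrM ger0_norm ?expR_ge0//.
apply: (@le_trans _ _ (expR (- A) * (272 * (tau ^+ 2 * expR (3 / 8 * y))))).
  rewrite ler_wpM2l ?expR_ge0// distrC.
  rewrite (_ : expR v - _ = (expR v - 1 - v) + (v - tau * (N - A))); last by ring.
  by rewrite (le_trans (ler_normD _ _))//; lra.
rewrite (_ : expR (- A) * _ = 272 * tau ^+ 2 * (expR (- A) * expR (3 / 8 * y))); last by ring.
rewrite (_ : 272 * _ * _ * _ = 272 * tau ^+ 2 * (expR (3 / 8 * N) * expR (- A / 2))); last by ring.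
apply: ler_wpM2l; first by rewrite mulr_ge0 ?sqr_ge0.
(* The growth in [A] costs 3/8 of the decay of [expR (- A)]; the remaining 5/8 exceed the required
   half. *)
rewrite -!expRD ler_expR /y; lra.
Qed.

End exponential_remainders.

(** * Monotonicity, L^p interpolation and finite sums of integrals *)

Section integral_complements.
Context d (T : measurableType d) (R : realType) (mu : {measure set T -> \bar R}).
Local Open Scope ereal_scope.

(* The integral of a nonnegative function is a supremum over the simple functions
   below it, so it is monotone even on nonmeasurable functions. *)
Lemma ge0_le_integralT (f g : T -> \bar R) :
  (forall x, 0 <= f x) -> (forall x, f x <= g x) ->
  \int[mu]_x f x <= \int[mu]_x g x.
Proof.
move=> f0 fg; have g0 x : 0 <= g x by exact: le_trans (f0 x) (fg x).
rewrite !ge0_integralTE//; apply: le_ereal_sup => _ [h hf <-].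
by exists h => // x; exact: le_trans (hf x) (fg x).
Qed.

(** For finite [p], integrate |g|^p <= S^(p-1) P and take the p-th root. Measurability is asked of
    the majorant, whose integral is evaluated; the comparison itself is [ge0_le_integralT]. *)
Lemma Lnorm_le_interpolation (g : T -> R) (P : T -> \bar R) (S L : R)
    (p : \bar R) :
  measurable_fun setT P -> (forall x, `|(g x)%:E| <= P x) ->
  (forall x, P x <= S%:E) -> \int[mu]_x P x <= L%:E ->
  (0 <= S)%R -> (0 <= L)%R -> 1 <= p ->
  'N[mu]_p[EFin \o g] <= (S `^ (1 - fine p^-1) * L `^ (fine p^-1))%:E.
Proof.
move=> mP gP PS PL S0 L0; have P0 x : 0 <= P x by exact: le_trans (gP x).
rewrite unlock; case: p => [p| |//] p1; last first.
  (* At [p = +oo] the exponent 1/p is 0 and the bound reduces to [S]. *)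
  rewrite invey/= subr0 powRr1// powRr0 mulr1.
  case: ifPn => // _; apply/ess_supP; apply: nearW => x /=.
  exact: le_trans (gP x) (PS x).
move: p1; rewrite lee_fin => p1; have p0 : (0 < p)%R by lra.
rewrite inver gt_eqF//=.
have h : \int[mu]_x `|(g x)%:E| `^ p <= (S `^ (p - 1) * L)%:E.
  apply: (@le_trans _ _ (\int[mu]_x ((S `^ (p - 1))%:E * P x))); last first.
    rewrite ge0_integralZl// ?lee_fin ?powR_ge0// EFinM.
    by apply: lee_wpmul2l => //; rewrite lee_fin powR_ge0.
  apply: ge0_le_integralT => x; first exact: poweR_ge0.
  rewrite poweR_EFin -mulr_powRB1// EFinM muleC; apply: lee_pmul => //; last exact: gP.
  rewrite lee_fin; apply: ge0_ler_powR; rewrite ?nnegrE//; first lra.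
  by rewrite -lee_fin (le_trans (gP x)).
apply: (@le_trans _ _ ((S `^ (p - 1) * L)%:E `^ p^-1)).
  apply: gt0_ler_poweR; rewrite ?invr_ge0 ?(ltW p0)// in_itv/= leey andbT//.
  - by apply: integral_ge0 => x _; rewrite lee_fin powR_ge0.
  - by rewrite lee_fin mulr_ge0// powR_ge0.
rewrite poweR_EFin lee_fin powRM ?powR_ge0// -powRrM.
by rewrite mulrBl divff ?gt_eqF// mul1r.
Qed.

Lemma integrable_sumR (I : Type) (s : seq I) (h : I -> T -> R) :
  (forall i, mu.-integrable setT (EFin \o h i)) ->
  mu.-integrable setT (EFin \o (fun x => (\sum_(i <- s) h i x)%R)).
Proof.
move=> ih; have := integrable_sum measurableT s (P := xpredT) (fun i _ => ih i).
by apply: eq_integrable => // x _ /=; rewrite -sumEFin.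
Qed.

Lemma Rintegral_sum (I : Type) (s : seq I) (h : I -> T -> R) :
  (forall i, mu.-integrable setT (EFin \o h i)) ->
  (\int[mu]_x (\sum_(i <- s) h i x) = \sum_(i <- s) \int[mu]_x h i x)%R.
Proof.
move=> ih; elim: s => [|i s IH].
  under eq_Rintegral do rewrite big_nil.
  by rewrite big_nil /Rintegral integral0.
under eq_Rintegral do rewrite big_cons.
by rewrite big_cons RintegralD ?IH//; exact: integrable_sumR.
Qed.

End integral_complements.

(** * Gaussian integrals on R^n *)

Section gaussian_integral.
Context {R : realType}.

(** The normal density is [normal_peak] times [normal_fun] and has mass 1, so the integral is the
    inverse of the peak. *)
Lemma integral_normal_fun (m s : R) : s != 0 ->
  (\int[lebesgue_measure]_x (normal_fun m s x)%:E =
   (Num.sqrt (s ^+ 2 * pi *+ 2))%:E)%E.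
Proof.
move=> s0; have := integral_normal_pdf m s; rewrite normal_pdfE//.
under eq_integral do rewrite EFinM.
rewrite ge0_integralZl//; last 3 first.
- by apply/measurable_EFinP; exact: measurable_normal_fun.
- by move=> x _; rewrite lee_fin normal_fun_ge0.
- by rewrite lee_fin normal_peak_ge0.
move=> h; have p0 := normal_peak_gt0 s0.
rewrite -[LHS]mul1e -(mulVf (lt0r_neq0 p0)) EFinM -muleA h mule1.
by rewrite /normal_peak invrK.
Qed.

Lemma measurable_coordinate (n : nat) (i : 'I_n) :
  measurable_fun setT (fun x : Rn R n => tnth x i : R).
Proof. exact: measurable_tnth. Qed.

(** Tonelli's theorem splits off the first coordinate along R * R^n ~ R^(n+1), and induction treats
    the others. *)
Lemma integral_prod_coordinates (n : nat) (h : 'I_n -> R -> R) (c : R) :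
  (forall i, measurable_fun setT (h i)) -> (forall i x, 0 <= h i x) ->
  (forall i, \int[lebesgue_measure]_x (h i x)%:E = c%:E)%E ->
  (\int[@lebesgue_measure_n R n]_x (\prod_(i < n) h i (tnth x i))%:E =
   (c ^+ n)%:E)%E.
Proof.
elim: n h => [|n IH] h mh h0 hc.
  under eq_integral do rewrite big_ord0.
  rewrite integral_cst//= diracE mem_set//= mul1e expr0//.
have c0 : 0 <= c.
  by rewrite -lee_fin -(hc ord0); apply: integral_ge0 => x _; rewrite lee_fin.
have mprod k (g : 'I_k -> R -> R) : (forall i, measurable_fun setT (g i)) ->
    measurable_fun setT (fun x : Rn R k => \prod_(i < k) g i (tnth x i)).
  move=> mg; apply: measurable_prod => i _.
  apply: (@measurableT_comp _ _ _ _ _ _ (g i) _ (fun x : Rn R k => tnth x i)) => //.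
  exact: measurable_coordinate.
pose g (x : Rn R n) : R := \prod_(i < n) h (lift ord0 i) (tnth x i).
have mg : measurable_fun setT g by exact: (mprod _ (fun i => h (lift ord0 i))).
have g0 x : 0 <= g x by rewrite prodr_ge0.
have IHg : (\int[@lebesgue_measure_n R n]_x (g x)%:E = (c ^+ n)%:E)%E.
  exact: (IH (fun i => h (lift ord0 i))).
have gE x : \prod_(i < n.+1) h i (tnth (cons_pair x) i) = h ord0 x.1 * g x.2.
  by rewrite big_ord_recl; congr (_ * _); apply: eq_bigr => i _; rewrite tnthS.
pose prodm : {measure set (measurableTypeR R * Rn R n)%type -> \bar R} :=
  (lebesgue_measure \x @lebesgue_measure_n R n)%E.
have mh' : measurable_fun setT
    (fun x : Rn R n.+1 => (\prod_(i < n.+1) h i (tnth x i))%:E).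
  by apply/measurable_EFinP; exact: mprod.
have h0' : {in setT, forall x : Rn R n.+1,
    (0 <= (\prod_(i < n.+1) h i (tnth x i))%:E)%E}.
  by move=> x _; rewrite lee_fin prodr_ge0.
(* At [n.+1] the measure computes to this pushforward; with the product named as a measure, the
   change of variables applies. *)
transitivity (\int[pushforward prodm (@cons_pair R n)]_x
    (\prod_(i < n.+1) h i (tnth x i))%:E)%E.
  by apply: eq_measure_integral; first exact: measurable_cons_pair.
rewrite (ge0_integral_pushforward (@measurable_cons_pair R n) prodm measurableT mh' h0').
rewrite preimage_setT /=.
under eq_integral do rewrite gE.
rewrite fubini_tonelli1//; last 2 first.
- apply/measurable_EFinP; apply: measurable_funM.
    by apply: (measurableT_comp (mh ord0)); exact: measurable_fst.
  by apply: (measurableT_comp mg); exact: measurable_snd.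
- by move=> x; rewrite lee_fin mulr_ge0.
rewrite /fubini_F/=.
under eq_integral => x _.
  under eq_integral do rewrite EFinM.
  rewrite ge0_integralZl ?lee_fin//; last 2 first.
  - exact/measurable_EFinP.
  - by move=> y _; rewrite lee_fin.
  rewrite IHg -EFinM mulrC EFinM.
  over.
rewrite ge0_integralZl//; last 3 first.
- by apply/measurable_EFinP; exact: mh.
- by move=> y _; rewrite lee_fin.
- by rewrite lee_fin exprn_ge0.
by rewrite hc -EFinM exprSr.
Qed.

Lemma enorm_sqr (n : nat) (x : Rn R n) :
  enorm x ^+ 2 = \sum_(i < n) (tnth x i : R) ^+ 2.
Proof. by rewrite sqr_sqrtr// sumr_ge0// => i _; exact: sqr_ge0. Qed.

Lemma integral_gauss_n (n : nat) (y : Rn R n) (s : R) : 0 < s ->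
  (\int[@lebesgue_measure_n R n]_x (expR (- (enorm (tsub x y) ^+ 2 / s)))%:E =
   (Num.sqrt (s * pi) ^+ n)%:E)%E.
Proof.
(* With [2 * r ^+ 2 = s], each factor is a [normal_fun] of deviation [r] centred at a coordinate of
   [y]. *)
move=> s0; pose r : R := Num.sqrt (s / 2).
have r0 : r != 0 by rewrite gt_eqF// sqrtr_gt0 divr_gt0.
have r2 : r ^+ 2 *+ 2 = s by rewrite sqr_sqrtr ?divr_ge0 ?ltW// -mulr_natr divfK.
have -> : Num.sqrt (s * pi) = Num.sqrt (r ^+ 2 * pi *+ 2).
  by rewrite -mulrnAl r2.
pose h (i : 'I_n) : R -> R := normal_fun (tnth y i : R) r.
rewrite -(@integral_prod_coordinates n h).
- apply: eq_integral => x _; congr EFin.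
  rewrite enorm_sqr -expR_sum; congr expR.
  rewrite mulr_suml -sumrN; apply: eq_bigr => i _.
  by rewrite tnth_mktuple r2 mulNr.
- by move=> i; exact: measurable_normal_fun.
- by move=> i x; exact: normal_fun_ge0.
- by move=> i; exact: integral_normal_fun.
Qed.

End gaussian_integral.

(** * Euclidean norm and dot product on tuples *)

Section euclidean.
Context {R : realType} {n : nat}.
Implicit Types x y z : Rn R n.

Definition tdot x y : R := \sum_(i < n) (tnth x i : R) * (tnth y i : R).

(** Cauchy-Schwarz through Lagrange's identity: after symmetrizing in [i] and [j], twice the
    difference is a double sum of squares. *)
Lemma tdot_sqr_le x y : tdot x y ^+ 2 <= enorm x ^+ 2 * enorm y ^+ 2.
Proof.
rewrite !enorm_sqr /tdot.
set X := \sum_i _ ^+ 2; set Y := \sum_i (tnth y _ : R) ^+ 2.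
have XY : X * Y = \sum_(i < n) \sum_(j < n) (tnth x i : R) ^+ 2 * (tnth y j : R) ^+ 2.
  by rewrite /X /Y big_distrlr.
have YX : X * Y = \sum_(i < n) \sum_(j < n) (tnth x j : R) ^+ 2 * (tnth y i : R) ^+ 2.
  by rewrite XY exchange_big.
rewrite expr2 big_distrlr/=; set P := \sum_i \sum_j _.
suff : 0 <= X * Y + X * Y - (P + P) by lra.
rewrite {1}XY YX /P -!big_split -sumrB/=; apply: sumr_ge0 => i _.
rewrite -!big_split -sumrB/=; apply: sumr_ge0 => j _.
rewrite (_ : _ - _ = ((tnth x i : R) * tnth y j - (tnth x j : R) * tnth y i) ^+ 2).
  exact: sqr_ge0.
by ring.
Qed.

Lemma enorm_tsub_sqr x y : enorm (tsub x y) ^+ 2 =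
  \sum_(i < n) ((tnth x i : R) - tnth y i) ^+ 2.
Proof. by rewrite enorm_sqr; apply: eq_bigr => i _; rewrite tnth_mktuple. Qed.

Lemma enorm_tsub_sqrE x y z : enorm (tsub x y) ^+ 2 =
  enorm (tsub x z) ^+ 2 - 2 * tdot (tsub x z) (tsub y z) + enorm (tsub y z) ^+ 2.
Proof.
rewrite !enorm_tsub_sqr /tdot mulr_sumr -sumrB -big_split/=.
by apply: eq_bigr => i _; rewrite !tnth_mktuple; ring.
Qed.

Lemma enorm_tsub_sqr_le x y :
  enorm (tsub x y) ^+ 2 <= 2 * (enorm x ^+ 2 + enorm y ^+ 2).
Proof.
rewrite enorm_tsub_sqr !enorm_sqr -big_split mulr_sumr/=.
by apply: ler_sum => i _; have := sqr_ge0 ((tnth x i : R) + tnth y i); nra.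
Qed.

Lemma coordinate_sqr_le x i : (tnth x i : R) ^+ 2 <= enorm x ^+ 2.
Proof.
rewrite enorm_sqr (bigD1 i)//= lerDl sumr_ge0// => j _; exact: sqr_ge0.
Qed.

Lemma normM_coordinate_le x i j :
  `|(tnth x i : R) * tnth x j| <= enorm x ^+ 2.
Proof.
have := coordinate_sqr_le x i; have := coordinate_sqr_le x j.
set a := tnth x i; set b := tnth x j; set N := enorm x ^+ 2 => hb ha.
have := sqr_ge0 ((a : R) + b); have := sqr_ge0 ((a : R) - b) => *.
by rewrite ler_norml; apply/andP; split; nra.
Qed.

Lemma measurable_enorm_tsub_sqr d (T : measurableType d) (g h : T -> Rn R n) :
  measurable_fun setT g -> measurable_fun setT h ->
  measurable_fun setT (fun u => enorm (tsub (g u) (h u)) ^+ 2).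
Proof.
move=> mg mh; under eq_fun do rewrite enorm_tsub_sqr.
apply: measurable_sum => i; apply: measurable_funX; apply: measurable_funB.
- exact: (measurableT_comp (measurable_coordinate n i) mg).
- exact: (measurableT_comp (measurable_coordinate n i) mh).
Qed.

Lemma measurable_sqrt : measurable_fun setT (@Num.sqrt R).
Proof. by apply: continuous_measurable_fun; exact: sqrt_continuous. Qed.

Lemma measurable_enorm : measurable_fun setT (@enorm R n).
Proof.
apply: (@measurableT_comp _ _ _ _ _ _ (@Num.sqrt R)); first exact: measurable_sqrt.
by apply: measurable_sum => i; apply: measurable_funX; exact: measurable_coordinate.
Qed.

Lemma measurable_tsub_coordinate y i :
  measurable_fun setT (fun x => tnth (tsub x y) i : R).
Proof.
under eq_fun do rewrite tnth_mktuple.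
by apply: measurable_funB => //; exact: measurable_coordinate.
Qed.

End euclidean.

(** * Moments of the data about the centre of mass *)

Section heat_expansion.
Context {R : realType} {n : nat} (f : Rn R n -> R) (xs : Rn R n) (c0 : R).
Local Notation mu := (@lebesgue_measure_n R n).
Local Notation M := (\int[mu]_x f x).
Hypothesis hf : f \in Lfun mu 1%E.
Hypothesis hf2 : (\int[mu]_x ((1 + enorm x) ^+ 2 * `|f x|)%:E < +oo)%E.

Lemma measurable_data : measurable_fun setT f.
Proof. by move/Lfun1_integrable : hf => /measurable_int/measurable_EFinP. Qed.

(** At most quadratic growth about [xs] is quadratic growth about 0, which the weight in [hf2]
    dominates. The integrability of moments, kernels and Taylor terms rests on this bound. *)
Lemma integrable_moment (g : Rn R n -> R) (k : R) : measurable_fun setT g ->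
  (forall y, `|g y| <= k * (1 + enorm (tsub y xs) ^+ 2)) ->
  mu.-integrable setT (EFin \o (fun y => g y * f y)).
Proof.
move=> mg gk; have mf := measurable_data.
(* In 1 + |y - xs|^2 <= 1 + 2 |y|^2 + 2 |xs|^2, both 1 and |y|^2 are at most (1 + |y|)^2; this gives
   the factor [3 + 2 * enorm xs ^+ 2]. *)
pose K : R := `|k| * (3 + 2 * enorm xs ^+ 2).
have iW : mu.-integrable setT
    (fun x => (K * ((1 + enorm x) ^+ 2 * `|f x|))%:E).
  under eq_fun do rewrite EFinM.
  apply: integrableZl => //; apply/integrableP; split.
    apply/measurable_EFinP; apply: measurable_funM.
      by apply: measurable_funX; apply: measurable_funD => //; exact: measurable_enorm.
    exact: measurableT_comp.
  apply: le_lt_trans hf2; rewrite le_eqVlt; apply/orP; left; apply/eqP.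
  apply: eq_integral => x _; rewrite gee0_abs// lee_fin mulr_ge0//.
  by rewrite exprn_ge0// addr_ge0// sqrtr_ge0.
apply: le_integrable iW => //; first by apply/measurable_EFinP; exact: measurable_funM.
move=> y _ /=; rewrite lee_fin normrM (mulrA K) (normrM (K * _)) normr_id ler_wpM2r// (normrM K).
apply: le_trans (gk y) _.
have e0 : 0 <= enorm y := sqrtr_ge0 _.
have := enorm_tsub_sqr_le y xs.
set Z := enorm (tsub y xs) ^+ 2; set e := enorm y in e0 *.
have X0 : 0 <= enorm xs ^+ 2 := sqr_ge0 _; move: X0; set X := enorm xs ^+ 2 => X0 ZX.
rewrite (ger0_norm (sqr_ge0 (1 + e))) /K normrM normr_id -/X (@ger0_norm _ (3 + _)); last by lra.
rewrite -mulrA; apply: (@le_trans _ _ (`|k| * (1 + Z))).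
  by rewrite ler_wpM2r ?ler_norm// addr_ge0// sqr_ge0.
by rewrite ler_wpM2l//; nra.
Qed.

Lemma integrable_coordinate i :
  mu.-integrable setT (EFin \o (fun y => (tnth (tsub y xs) i : R) * f y)).
Proof.
apply: (@integrable_moment _ 1); first exact: measurable_tsub_coordinate.
move=> y; have := coordinate_sqr_le (tsub y xs) i.
set a := tnth _ i; set b := enorm _ ^+ 2 => ab.
rewrite mul1r ler_norml; have := sqr_ge0 ((a : R) - 1); have := sqr_ge0 ((a : R) + 1).
by move=> *; apply/andP; split; nra.
Qed.

Lemma integrable_coordinateM i j : mu.-integrable setT
  (EFin \o (fun y => (tnth (tsub y xs) i : R) * tnth (tsub y xs) j * f y)).
Proof.
apply: (@integrable_moment _ 1).
  by apply: measurable_funM; exact: measurable_tsub_coordinate.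
by move=> y; rewrite mul1r (le_trans (normM_coordinate_le _ _ _))// lerDr.
Qed.

Lemma integrable_data : mu.-integrable setT (EFin \o f).
Proof. exact/Lfun1_integrable. Qed.

Hypothesis hxs : forall i : 'I_n,
  tnth xs i * M = \int[mu]_x (tnth x i * f x).
Hypothesis hc0 : forall i j : 'I_n,
  2^-1 * \int[mu]_x (tnth x i * tnth x j * f x)
  - 2^-1 * M * tnth xs i * tnth xs j = c0 * (i == j)%:R.

(** By [hxs], [xs] is the centre of mass of [f]. *)
Lemma centered_moment1 i : \int[mu]_y ((tnth (tsub y xs) i : R) * f y) = 0.
Proof.
have -> : \int[mu]_y ((tnth (tsub y xs) i : R) * f y) = 
  \int[mu]_y ((tnth y i : R) * f y) - (tnth xs i : R) * M; last by rewrite -hxs subrr.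
have id := integrable_data.
have ic : mu.-integrable setT (EFin \o (fun y => (tnth y i : R) * f y)).
  have := integrableD measurableT (integrable_coordinate i)
    (integrableZl measurableT (tnth xs i : R) id).
  apply: eq_integrable => // y _ /=.
  by rewrite -EFinM -EFinD tnth_mktuple; congr EFin; ring.
rewrite -RintegralZl// -RintegralB//; last exact: (integrableZl measurableT (tnth xs i : R) id).
by apply: eq_Rintegral => y _; rewrite tnth_mktuple mulrBl.
Qed.

(** Write y_i y_j as z_i z_j + b z_i + a z_j + a b with z = y - xs. The linear terms integrate to 0,
    and [hc0] evaluates what is left. *)
Lemma centered_moment2 i j :
  \int[mu]_y ((tnth (tsub y xs) i : R) * tnth (tsub y xs) j * f y) =
  2 * c0 * (i == j)%:R.
Proof.
have id := integrable_data.
pose a : R := tnth xs i; pose b : R := tnth xs j.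
pose Z := fun y => (tnth (tsub y xs) i : R) * tnth (tsub y xs) j * f y.
pose Zi := fun y => b * ((tnth (tsub y xs) i : R) * f y).
pose Zj := fun y => a * ((tnth (tsub y xs) j : R) * f y).
have iZ : mu.-integrable setT (EFin \o Z) := integrable_coordinateM i j.
have iZi : mu.-integrable setT (EFin \o Zi).
  exact: (integrableZl measurableT b (integrable_coordinate i)).
have iZj : mu.-integrable setT (EFin \o Zj).
  exact: (integrableZl measurableT a (integrable_coordinate j)).
have iM : mu.-integrable setT (EFin \o (fun y => a * b * f y)).
  exact: (integrableZl measurableT (a * b) id).
have iZZ : mu.-integrable setT (EFin \o (fun y => Z y + Zi y)).
  exact: (integrableD measurableT iZ iZi).
have iZZZ : mu.-integrable setT (EFin \o (fun y => Z y + Zi y + Zj y)).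
  exact: (integrableD measurableT iZZ iZj).
have E : \int[mu]_y ((tnth y i : R) * tnth y j * f y) = \int[mu]_y Z y + a * b * M.
  transitivity (\int[mu]_y (Z y + Zi y + Zj y + a * b * f y)).
    apply: eq_Rintegral => y _; rewrite /Z /Zi /Zj !tnth_mktuple /a /b.
    by ring.
  rewrite RintegralD// RintegralD// RintegralD// RintegralZl//.
  rewrite /Zi RintegralZl ?centered_moment1 ?mulr0 ?addr0//; last exact: integrable_coordinate.
  rewrite /Zj RintegralZl ?centered_moment1 ?mulr0 ?addr0//; exact: integrable_coordinate.
have := hc0 i j; rewrite E -/Z -/a -/b; set d := _%:R; lra.
Qed.

(** * Second order expansion of the solution in scaled variables *)

Definition heat_prefactor (t : R) : R := (4 * pi * t) `^ (- (n%:R / 2)).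

(** For [t > 0], this and [scaled_dot] are |b|^2 and a.b of the overview; dividing quadratic
    quantities by [4 * t] avoids square roots of [t]. *)
Definition scaled_dist_sqr (t : R) (y : Rn R n) : R :=
  enorm (tsub y xs) ^+ 2 / (4 * t).

Definition scaled_dot (t : R) (x y : Rn R n) : R :=
  tdot (tsub x xs) (tsub y xs) / (4 * t).

Lemma heat_prefactor_ge0 t : 0 <= heat_prefactor t.
Proof. exact: powR_ge0. Qed.

Lemma scaled_dist_sqr_ge0 t y : 0 < t -> 0 <= scaled_dist_sqr t y.
Proof. by move=> t0; rewrite divr_ge0 ?sqr_ge0// mulr_ge0// ltW. Qed.

Lemma scaled_dot_sqr_le t x y : 0 < t ->
  scaled_dot t x y ^+ 2 <= scaled_dist_sqr t x * scaled_dist_sqr t y.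
Proof.
move=> t0; rewrite expr_div_n mulf_div -expr2 ler_wpM2r ?tdot_sqr_le//.
by rewrite invr_ge0 sqr_ge0.
Qed.

Lemma enorm_tsub_sqr_scaled t x y : enorm (tsub x y) ^+ 2 / (4 * t) =
  scaled_dist_sqr t x - 2 * scaled_dot t x y + scaled_dist_sqr t y.
Proof.
rewrite (enorm_tsub_sqrE x y xs) /scaled_dist_sqr /scaled_dot.
by set v := (4 * t)^-1; ring.
Qed.

Lemma measurable_scaled_dist_sqr t : measurable_fun setT (scaled_dist_sqr t).
Proof.
by apply: measurable_funM => //; exact: measurable_enorm_tsub_sqr.
Qed.

(** Separates the variables: each summand is a coefficient free of [y] times the integrand of a
    centred moment of order 0, 1 or 2. *)
Lemma taylor_term_sum t x y : t != 0 ->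
  (1 + 2 * scaled_dot t x y - scaled_dist_sqr t y + 2 * scaled_dot t x y ^+ 2) * f y =
  f y + \sum_(i < n) (tnth (tsub x xs) i / (2 * t)) * ((tnth (tsub y xs) i : R) * f y)
  + \sum_(i < n) (- (4 * t)^-1) * ((tnth (tsub y xs) i : R) * tnth (tsub y xs) i * f y)
  + \sum_(i < n) \sum_(j < n)
    ((tnth (tsub x xs) i : R) * tnth (tsub x xs) j / (8 * t ^+ 2)) *
    ((tnth (tsub y xs) i : R) * tnth (tsub y xs) j * f y).
Proof.
move=> t0; set w := tsub x xs; set z := tsub y xs.
have e1 : 2 * scaled_dot t x y * f y = \sum_(i < n) (tnth w i / (2 * t)) * ((tnth z i : R) * f y).
  rewrite /scaled_dot /tdot mulr_suml mulr_sumr mulr_suml; apply: eq_bigr => i _.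
  by field.
have e2 : - (scaled_dist_sqr t y * f y) =
    \sum_(i < n) (- (4 * t)^-1) * ((tnth z i : R) * tnth z i * f y).
  rewrite /scaled_dist_sqr enorm_sqr !mulr_suml -sumrN; apply: eq_bigr => i _.
  by rewrite -/z; field.
have e3 : 2 * scaled_dot t x y ^+ 2 * f y = \sum_(i < n) \sum_(j < n)
    ((tnth w i : R) * tnth w j / (8 * t ^+ 2)) * ((tnth z i : R) * tnth z j * f y).
  rewrite /scaled_dot /tdot expr2 mulf_div big_distrlr/= !mulr_suml mulr_sumr mulr_suml.
  apply: eq_bigr => i _; rewrite !mulr_suml mulr_sumr mulr_suml.
  by apply: eq_bigr => j _; rewrite -/w -/z; field.
by rewrite -e1 -e2 -e3; ring.
Qed.

(** First and off-diagonal second moments vanish, and each diagonal one is [2 * c0]. Multiplied by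
    G_t(x - xs) the result is M G_t + c0 (Laplacian G_t), since the Laplacian of G_t is its time
    derivative. *)
Lemma taylor_term_integral t x : 0 < t ->
  let Q y := 1 + 2 * scaled_dot t x y - scaled_dist_sqr t y
             + 2 * scaled_dot t x y ^+ 2 in
  mu.-integrable setT (EFin \o (fun y => Q y * f y)) /\
  \int[mu]_y (Q y * f y) = M - c0 / t * (n%:R / 2 - scaled_dist_sqr t x).
Proof.
move=> t0 Q; have tn0 : t != 0 by rewrite gt_eqF.
set w := tsub x xs.
pose F1 y := \sum_(i < n) (tnth w i / (2 * t)) * ((tnth (tsub y xs) i : R) * f y).
pose F2 y := \sum_(i < n) (- (4 * t)^-1) *
  ((tnth (tsub y xs) i : R) * tnth (tsub y xs) i * f y).
pose F3 y := \sum_(i < n) \sum_(j < n) ((tnth w i : R) * tnth w j / (8 * t ^+ 2)) *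
  ((tnth (tsub y xs) i : R) * tnth (tsub y xs) j * f y).
have QE y : Q y * f y = f y + F1 y + F2 y + F3 y by exact: taylor_term_sum.
have i1 i : mu.-integrable setT (EFin \o (fun y => (tnth w i / (2 * t)) *
    ((tnth (tsub y xs) i : R) * f y))).
  exact: (integrableZl measurableT _ (integrable_coordinate i)).
have i2 i : mu.-integrable setT (EFin \o (fun y => (- (4 * t)^-1) *
    ((tnth (tsub y xs) i : R) * tnth (tsub y xs) i * f y))).
  exact: (integrableZl measurableT _ (integrable_coordinateM i i)).
have i3 i j : mu.-integrable setT (EFin \o (fun y =>
    ((tnth w i : R) * tnth w j / (8 * t ^+ 2)) *
    ((tnth (tsub y xs) i : R) * tnth (tsub y xs) j * f y))).
  exact: (integrableZl measurableT _ (integrable_coordinateM i j)).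
have iF1 : mu.-integrable setT (EFin \o F1) by exact: integrable_sumR.
have iF2 : mu.-integrable setT (EFin \o F2) by exact: integrable_sumR.
have i3' i := integrable_sumR _ _ _ mu _ (index_enum 'I_n) _ (i3 i).
have iF3 : mu.-integrable setT (EFin \o F3) by exact: integrable_sumR.
have id := integrable_data.
have j1 : mu.-integrable setT (EFin \o (fun y => f y + F1 y)).
  exact: (integrableD measurableT id iF1).
have j2 : mu.-integrable setT (EFin \o (fun y => f y + F1 y + F2 y)).
  exact: (integrableD measurableT j1 iF2).
have j3 : mu.-integrable setT (EFin \o (fun y => f y + F1 y + F2 y + F3 y)).
  exact: (integrableD measurableT j2 iF3).
split; first by rewrite (_ : (fun y => Q y * f y) = (fun y => f y + F1 y + F2 y + F3 y))//; apply/funext.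
under eq_Rintegral do rewrite QE.
rewrite !RintegralD// /F1 /F2 /F3.
rewrite Rintegral_sum// big1; last first.
  by move=> i _; rewrite RintegralZl// ?centered_moment1 ?mulr0//; exact: integrable_coordinate.
rewrite Rintegral_sum// (eq_bigr (fun=> - (4 * t)^-1 * (2 * c0))); last first.
  move=> i _; rewrite RintegralZl// ?centered_moment2 ?eqxx ?mulr1//.
  exact: integrable_coordinateM.
rewrite sumr_const card_ord.
rewrite Rintegral_sum// (eq_bigr (fun i => (tnth w i : R) ^+ 2 * (c0 / (4 * t ^+ 2)))); last first.
  move=> i _; rewrite Rintegral_sum// (bigD1 i)//= big1 ?addr0; last first.
    move=> j ji; rewrite RintegralZl// ?centered_moment2; last exact: integrable_coordinateM.
    by rewrite eq_sym (negbTE ji) !mulr0.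
  rewrite RintegralZl// ?centered_moment2 ?eqxx ?mulr1; last exact: integrable_coordinateM.
  by field.
rewrite -mulr_suml -enorm_sqr /scaled_dist_sqr -/w -mulr_natr.
by field.
Qed.

Lemma heat_kernel_scaledE t x y : heat_kernel t (tsub x y) = heat_prefactor t *
  expR (- (scaled_dist_sqr t x - 2 * scaled_dot t x y + scaled_dist_sqr t y)).
Proof. by rewrite /heat_kernel enorm_tsub_sqr_scaled. Qed.

Lemma measurable_heat_kernel_tsub t x :
  measurable_fun setT (fun y : Rn R n => heat_kernel t (tsub x y)).
Proof.
apply: measurable_funM => //; apply: measurableT_comp => //.
apply: measurableT_comp => //; apply: measurable_funM => //.
exact: measurable_enorm_tsub_sqr.
Qed.

Lemma integrable_heat_kernel t x : 0 < t ->
  mu.-integrable setT (EFin \o (fun y => heat_kernel t (tsub x y) * f y)).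
Proof.
move=> t0; apply: (@integrable_moment _ (heat_prefactor t)).
  exact: measurable_heat_kernel_tsub.
move=> y; have k0 := heat_prefactor_ge0 t.
rewrite ger0_norm; last by rewrite mulr_ge0 ?expR_ge0.
apply: ler_wpM2l => //; apply: (@le_trans _ _ 1); last by rewrite lerDl sqr_ge0.
by rewrite -expR0 ler_expR oppr_le0 divr_ge0 ?sqr_ge0// mulr_ge0// ltW.
Qed.

Lemma heat_solution_expansion t x : 0 < t ->
  let rem y := heat_prefactor t *
    gauss_remainder (scaled_dist_sqr t x) (scaled_dist_sqr t y)
      (scaled_dot t x y) * f y in
  mu.-integrable setT (EFin \o rem) /\
  heat_solution f x t = heat_prefactor t * expR (- scaled_dist_sqr t x) *
    (M - c0 / t * (n%:R / 2 - scaled_dist_sqr t x)) + \int[mu]_y rem y.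
Proof.
move=> t0 rem; have /= [iQ EQ] := taylor_term_integral t x t0.
set Q := fun y => _ in iQ EQ.
set k := heat_prefactor t * expR (- scaled_dist_sqr t x).
have ih := integrable_heat_kernel t x t0.
have ikQ : mu.-integrable setT (EFin \o (fun y => k * Q y)).
  exact: (integrableZl measurableT k iQ).
(* The remainder is integrable as a difference of integrable functions. *)
have remE : rem = (fun y => heat_kernel t (tsub x y) * f y - k * Q y).
  apply/funext => y; rewrite heat_kernel_scaledE /rem /gauss_remainder /Q /k.
  by ring.
rewrite remE; split; first exact: (integrableB measurableT ih ikQ).
by rewrite RintegralB// RintegralZl// EQ /heat_solution; ring.
Qed.

(** * The weighted second moment is o(1/t) *)

Definition moment_weight (t : R) (y : Rn R n) : R :=
  scaled_dist_sqr t y * Num.min 1 (Num.sqrt (scaled_dist_sqr t y)) * `|f y|.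

Lemma min1_sqrt_itv (b : R) : 0 <= Num.min 1 (Num.sqrt b) <= 1.
Proof. by rewrite le_min ler01 sqrtr_ge0 ge_min lexx. Qed.

Lemma moment_weight_ge0 t y : 0 < t -> 0 <= moment_weight t y.
Proof.
move=> t0; have /andP[m0 _] := min1_sqrt_itv (scaled_dist_sqr t y).
by apply: mulr_ge0 => //; apply: mulr_ge0 => //; exact: scaled_dist_sqr_ge0.
Qed.

Lemma measurable_moment_weight t : measurable_fun setT (moment_weight t).
Proof.
have mB := measurable_scaled_dist_sqr t.
apply: measurable_funM; last by apply: measurableT_comp => //; exact: measurable_data.
apply: measurable_funM => //; apply: measurable_minr => //.
by apply: measurableT_comp => //; exact: measurable_sqrt.
Qed.

Lemma integrable_enorm_tsub_sqr : mu.-integrable setT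
  (EFin \o (fun y => enorm (tsub y xs) ^+ 2 / 4 * `|f y|)).
Proof.
have : mu.-integrable setT (EFin \o (fun y => enorm (tsub y xs) ^+ 2 / 4 * f y)).
  apply: (@integrable_moment _ 1).
    by apply: measurable_funM => //; exact: measurable_enorm_tsub_sqr.
  move=> y; have := sqr_ge0 (enorm (tsub y xs)); set Z := _ ^+ 2 => Z0.
  by rewrite ger0_norm ?divr_ge0//; lra.
move=> /integrable_abse; apply: eq_integrable => // y _ /=.
by rewrite normrM ger0_norm// divr_ge0// sqr_ge0.
Qed.

(** The factor [t] cancels the one in [scaled_dist_sqr] and the minimum is at most 1. The bound
    covers every real [t], because dominated convergence runs along sequences whose first terms may
    fail to be positive. *)
Lemma norm_mul_moment_weight_le t y :
  `|t * moment_weight t y| <= enorm (tsub y xs) ^+ 2 / 4 * `|f y|.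
Proof.
have Z0 := sqr_ge0 (enorm (tsub y xs)).
have [->|tn0] := eqVneq t 0.
  by rewrite mul0r normr0 mulr_ge0// divr_ge0.
have /andP[m0 m1] := min1_sqrt_itv (scaled_dist_sqr t y).
rewrite /moment_weight mulrA (mulrA t) (_ : t * scaled_dist_sqr t y = enorm (tsub y xs) ^+ 2 / 4); last first.
  by rewrite /scaled_dist_sqr; field.
rewrite normrM normr_id ler_wpM2r// normrM (ger0_norm m0) (@ger0_norm _ (_ / 4)) ?divr_ge0//.
by rewrite ler_piMr// divr_ge0.
Qed.

Lemma integrable_mul_moment_weight t :
  mu.-integrable setT (EFin \o (fun y => t * moment_weight t y)).
Proof.
apply: le_integrable integrable_enorm_tsub_sqr => //.
  by apply/measurable_EFinP; apply: measurable_funM => //; exact: measurable_moment_weight.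
move=> y _ /=; rewrite lee_fin (le_trans (norm_mul_moment_weight_le t y))//.
exact: ler_norm.
Qed.

Lemma integrable_moment_weight t : t != 0 ->
  mu.-integrable setT (EFin \o moment_weight t).
Proof.
move=> t0; have := integrableZl measurableT t^-1 (integrable_mul_moment_weight t).
by apply: eq_integrable => // y _ /=; rewrite -EFinM mulKf.
Qed.

(** Bounding the minimum by its second argument leaves a fixed multiple of t^(-1/2). *)
Lemma cvg_mul_moment_weight y : t * moment_weight t y @[t --> +oo] --> 0.
Proof.
pose Z := enorm (tsub y xs) ^+ 2; pose C := Z / 4 * `|f y|.
have Z0 : 0 <= Z := sqr_ge0 _.
have C0 : 0 <= C by rewrite mulr_ge0// divr_ge0.
have cV : (t^-1 : R) @[t --> +oo] --> (0 : R).
  apply/gtr0_cvgV0; last exact: cvg_id.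
  exact: nbhs_pinfty_gt.
have cs : C * Num.sqrt (Z / 4 * t^-1) @[t --> +oo] --> C * Num.sqrt (Z / 4 * 0).
  apply: cvgM; first exact: cvg_cst.
  apply: (cvg_comp (fun t => Z / 4 * t^-1) (@Num.sqrt R)); last exact: sqrt_continuous.
  by apply: cvgM => //; exact: cvg_cst.
rewrite mulr0 sqrtr0 mulr0 in cs.
apply: (squeeze_cvgr _ (cvg_cst (0 : R)) cs).
near=> t; have t0 : 0 < t by near: t; exact: nbhs_pinfty_gt.
rewrite mulr_ge0 ?moment_weight_ge0 ?(ltW t0)//=.
rewrite /moment_weight mulrA (mulrA t) (_ : t * scaled_dist_sqr t y = Z / 4); last first.
  by rewrite /scaled_dist_sqr -/Z; field; rewrite gt_eqF.
rewrite mulrAC -/C ler_wpM2l// ge_min; apply/orP; right.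
by rewrite /scaled_dist_sqr -/Z invfM mulrA.
Unshelve. all: by end_near.
Qed.

(** Dominated convergence along arbitrary sequences tending to infinity, with the integrable
    majorant |y - xs|^2 |f| / 4. This is the source of the little-o in the theorem. *)
Lemma cvg_integral_moment_weight :
  t * \int[mu]_y moment_weight t y @[t --> +oo] --> 0.
Proof.
apply/cvg_pinftyP => u uoo.
pose g k := EFin \o (fun y => u k * moment_weight (u k) y).
have mg k : measurable_fun setT (g k).
  by apply/measurable_EFinP; apply: measurable_funM => //; exact: measurable_moment_weight.
have cg : {ae mu, forall y, setT y -> g ^~ y @ \oo --> (cst 0 y : \bar R)}.
  apply: aeW => y _; apply/cvg_EFin; first exact: nearW.
  by move/cvg_pinftyP : (cvg_mul_moment_weight y); exact.
have dg : {ae mu, forall y k, setT y -> (`|g k y| <= (enorm (tsub y xs) ^+ 2 / 4 * `|f y|)%:E)%E}.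
  by apply: aeW => y k _; rewrite lee_fin norm_mul_moment_weight_le.
have [_ _] := dominated_convergence measurableT mg (measurable_cst _) cg
  integrable_enorm_tsub_sqr dg.
rewrite integral0 => /fine_cvg.
apply: cvg_trans; apply: near_eq_cvg; near=> k => /=.
have uk : 0 < u k by near: k; move/cvgryPgt : uoo; exact.
rewrite -[LHS]/(\int[mu]_y (u k * moment_weight (u k) y)) RintegralZl//.
by apply: integrable_moment_weight; rewrite gt_eqF.
Unshelve. all: by end_near.
Qed.

(** * Gaussians of width sqrt t and their mass *)

Definition gauss_bump (t : R) (x y : Rn R n) : R :=
  expR (- (enorm (tsub x y) ^+ 2 / (8 * t))).

Lemma gauss_bump_ge0 t x y : 0 <= gauss_bump t x y.
Proof. exact: expR_ge0. Qed.

Lemma gauss_bump_le1 t x y : 0 < t -> gauss_bump t x y <= 1.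
Proof.
by move=> t0; rewrite -expR0 ler_expR oppr_le0 divr_ge0 ?sqr_ge0// mulr_ge0// ltW.
Qed.

(** The 8 in [gauss_bump] is 2 * 4, which makes it exp(-|a - b|^2 / 2), a factor of the bound in
    [norm_gauss_remainder_le]. *)
Lemma gauss_bumpE t x y : gauss_bump t x y = expR (- (scaled_dist_sqr t x
  - 2 * scaled_dot t x y + scaled_dist_sqr t y) / 2).
Proof.
rewrite -enorm_tsub_sqr_scaled /gauss_bump; congr expR.
have -> : (8 * t)^-1 = (4 * t)^-1 / 2 by rewrite -invfM; congr (_^-1); ring.
by set v := (4 * t)^-1; ring.
Qed.

Lemma gauss_bump_centerE t x : gauss_bump t x xs = expR (- scaled_dist_sqr t x / 2).
Proof.
rewrite /gauss_bump /scaled_dist_sqr; congr expR.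
have -> : (8 * t)^-1 = (4 * t)^-1 / 2 by rewrite -invfM; congr (_^-1); ring.
by set v := (4 * t)^-1; ring.
Qed.

Lemma measurable_gauss_bump d (T : measurableType d) t (g h : T -> Rn R n) :
  measurable_fun setT g -> measurable_fun setT h ->
  measurable_fun setT (fun u => gauss_bump t (g u) (h u)).
Proof.
move=> mg mh; apply: measurableT_comp => //; apply: measurableT_comp => //.
by apply: measurable_funM => //; exact: measurable_enorm_tsub_sqr.
Qed.

Lemma heat_prefactor_inv t : 0 <= t ->
  heat_prefactor t = (Num.sqrt (4 * pi * t) ^+ n)^-1.
Proof.
move=> t0; have p0 : 0 <= 4 * pi * t by rewrite !mulr_ge0 ?pi_ge0.
by rewrite /heat_prefactor powRN (mulrC n%:R) powRrM powR12_sqrt// powR_mulrn ?sqrtr_ge0.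
Qed.

(** The bump has twice the variance of the heat kernel, hence sqrt 2 ^ n times its mass, whatever
    [t] and [y] are. *)
Lemma integral_gauss_bump t y : 0 < t ->
  (\int[mu]_x (heat_prefactor t * gauss_bump t x y)%:E = (Num.sqrt 2 ^+ n)%:E)%E.
Proof.
move=> t0; under eq_integral do rewrite EFinM.
rewrite ge0_integralZl//; last 3 first.
- by apply/measurable_EFinP; exact: measurable_gauss_bump.
- by move=> x _; rewrite lee_fin gauss_bump_ge0.
- by rewrite lee_fin heat_prefactor_ge0.
rewrite integral_gauss_n ?mulr_gt0// -EFinM heat_prefactor_inv ?ltW//.
have -> : 8 * t * pi = 2 * (4 * pi * t) by ring.
rewrite (sqrtrM (4 * pi * t) (ler0n R 2)) exprMn mulrCA mulVf ?mulr1//.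
by rewrite expf_neq0// gt_eqF// sqrtr_gt0 !mulr_gt0 ?pi_gt0.
Qed.

(** * A majorant of the error, its supremum and its integral *)

Variable ts : R.
Hypothesis hts : c0 + ts * M = 0.

(* The constants of [norm_gauss_remainder_le] and [norm_heat_time_remainder_le]. *)
Local Notation C1 := (54 * expR 10 : R).
Local Notation C2 := (272 * expR (3 / 8 * (n%:R / 2)) : R).

(** The integral bounds the spatial Taylor remainder, the last term the time expansion. Extended
    real values let Tonelli's theorem apply with no finiteness to check. *)
Definition heat_majorant (t : R) (x : Rn R n) : \bar R :=
  (\int[mu]_y (C1 * moment_weight t y * (heat_prefactor t *
     (gauss_bump t x y + gauss_bump t x xs)))%:E +
   (`|M| * C2 * (ts / t) ^+ 2 * (heat_prefactor t * gauss_bump t x xs))%:E)%E.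

(** With [tau = ts / t], the shifted time is t (1 - tau), so the modified kernel has the form
    treated in [norm_heat_time_remainder_le]. *)
Lemma heat_error_le_majorant t x : 0 < t -> `|ts / t| <= 16^-1 ->
  (`|(heat_solution f x t - modified_heat_kernel0 f xs ts t x)%:E|
   <= heat_majorant t x)%E.
Proof.
move=> t0 tau16; have tn0 : t != 0 by rewrite gt_eqF.
set tau := ts / t; set k := heat_prefactor t; set A := scaled_dist_sqr t x.
have k0 : 0 <= k := heat_prefactor_ge0 t.
have A0 : 0 <= A by exact: scaled_dist_sqr_ge0.
have tau1 : 0 < 1 - tau.
  by move: tau16; rewrite -/tau ler_norml => /andP[_ ?]; lra.
have /= [irem ->] := heat_solution_expansion t x t0.
set rem := fun y => _ in irem *.
have GE : modified_heat_kernel0 f xs ts t x =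
    M * (k * ((1 - tau) `^ (- (n%:R / 2)) * expR (- (A / (1 - tau))))).
  rewrite /modified_heat_kernel0 /heat_kernel; congr (_ * _).
  have tsE : t - ts = t * (1 - tau) by rewrite /tau; field.
  rewrite tsE (mulrA (4 * pi) t) powRM ?(ltW tau1)//; last first.
    by rewrite !mulr_ge0 ?pi_ge0// ltW.
  rewrite -[LHS]mulrA; congr (_ * (_ * expR (- _))).
  by rewrite /A /scaled_dist_sqr (mulrA 4 t) invfM mulrA.
have c0E : c0 = - (ts * M) by move: hts; lra.
(* Since [c0 = - (ts * M)], the second moment term is the first order term in [tau] of the modified
   kernel. *)
have -> : k * expR (- A) * (M - c0 / t * (n%:R / 2 - A)) + \int[mu]_y rem y -
    modified_heat_kernel0 f xs ts t x = \int[mu]_y rem y +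
    M * k * (expR (- A) * (1 - tau * (A - n%:R / 2)) -
      (1 - tau) `^ (- (n%:R / 2)) * expR (- (A / (1 - tau)))).
  by rewrite GE c0E /tau; field.
set I := \int[mu]_y rem y; set E2 := M * k * _.
apply: (@le_trans _ _ (`|I%:E| + `|E2%:E|)%E); first by rewrite -EFinD lee_fin ler_normD.
apply: leeD; last first.
  rewrite lee_fin /E2 2!normrM (ger0_norm k0) -/tau.
  have := norm_heat_time_remainder_le (n%:R / 2) A tau (divr_ge0 (ler0n _ _) (ler0n _ _)) A0 tau16.
  set X := `|_ - _| => hX.
  rewrite gauss_bump_centerE -/A (_ : `|M| * C2 * tau ^+ 2 * (k * expR (- A / 2)) =
    `|M| * k * (C2 * tau ^+ 2 * expR (- A / 2))); last by ring.
  by rewrite ler_wpM2l ?mulr_ge0.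
rewrite /I /Rintegral fineK; last exact: integrable_fin_num.
apply: le_trans (le_abse_integral _ _ _) _ => //; first exact: measurable_int irem.
apply: ge0_le_integralT => y; first exact: abse_ge0.
rewrite lee_fin /rem 2!normrM (ger0_norm (heat_prefactor_ge0 t)) -/k.
have B0 : 0 <= scaled_dist_sqr t y by exact: scaled_dist_sqr_ge0.
have := norm_gauss_remainder_le A (scaled_dist_sqr t y) (scaled_dot t x y) A0 B0
  (scaled_dot_sqr_le t x y t0).
rewrite -gauss_bumpE -gauss_bump_centerE => h.
rewrite /moment_weight -/A.
set m := scaled_dist_sqr t y * _ in h *.
rewrite (_ : C1 * (m * `|f y|) * _ =
  k * (C1 * m * (gauss_bump t x y + gauss_bump t x xs)) * `|f y|); last by ring.
by rewrite ler_wpM2r// ler_wpM2l.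
Qed.

Lemma time_rate_ge0 t : 0 <= `|M| * C2 * (ts / t) ^+ 2.
Proof.
apply: mulr_ge0; last exact: sqr_ge0.
by apply: mulr_ge0 => //; apply: mulr_ge0 => //; exact: expR_ge0.
Qed.

(** Up to constants this is eps(t) / t of the overview; the factor 2 counts the two bumps of the
    majorant. *)
Definition heat_rate (t : R) : R :=
  2 * C1 * \int[mu]_y moment_weight t y + `|M| * C2 * (ts / t) ^+ 2.

Lemma heat_rate_ge0 t : 0 < t -> 0 <= heat_rate t.
Proof.
move=> t0; apply: addr_ge0; last exact: time_rate_ge0.
apply: mulr_ge0; first by rewrite !mulr_ge0 ?expR_ge0.
by apply: Rintegral_ge0 => y _; exact: moment_weight_ge0.
Qed.

Lemma integral_moment_weightE t : 0 < t ->
  (\int[mu]_y (moment_weight t y)%:E = (\int[mu]_y moment_weight t y)%:E)%E.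
Proof.
move=> t0; rewrite /Rintegral fineK//; apply: integrable_fin_num => //.
by apply: integrable_moment_weight; rewrite gt_eqF.
Qed.

Definition majorant_integrand (t : R) (u : Rn R n * Rn R n) : \bar R :=
  (C1 * moment_weight t u.2 * (heat_prefactor t *
     (gauss_bump t u.1 u.2 + gauss_bump t u.1 xs)))%:E.

Lemma majorant_integrand_ge0 t u : 0 < t -> (0 <= majorant_integrand t u)%E.
Proof.
move=> t0; rewrite lee_fin; apply: mulr_ge0; apply: mulr_ge0.
- by rewrite mulr_ge0// expR_ge0.
- exact: moment_weight_ge0.
- exact: heat_prefactor_ge0.
- by rewrite addr_ge0 ?gauss_bump_ge0.
Qed.

Lemma heat_majorant_le t x : 0 < t ->
  (heat_majorant t x <= (heat_prefactor t * heat_rate t)%:E)%E.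
Proof.
move=> t0; have k0 := heat_prefactor_ge0 t.
rewrite /heat_rate mulrDr EFinD; apply: leeD; last first.
  rewrite lee_fin mulrCA ler_wpM2l//.
  by rewrite ler_piMr ?gauss_bump_le1// time_rate_ge0.
apply: (@le_trans _ _ (\int[mu]_y ((heat_prefactor t * (2 * C1))%:E * (moment_weight t y)%:E))%E).
  apply: ge0_le_integralT => y; first exact: (majorant_integrand_ge0 t (x, y) t0).
  rewrite lee_fin.
  rewrite (_ : C1 * _ * _ = heat_prefactor t * C1 * moment_weight t y *
    (gauss_bump t x y + gauss_bump t x xs)); last by ring.
  rewrite (_ : _ * (2 * C1) * _ = heat_prefactor t * C1 * moment_weight t y * 2); last by ring.
  apply: ler_wpM2l.
    apply: mulr_ge0; last exact: moment_weight_ge0.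
    by rewrite mulr_ge0// mulr_ge0// expR_ge0.
  by have := gauss_bump_le1 t x y t0; have := gauss_bump_le1 t x xs t0; lra.
rewrite ge0_integralZl//; last 3 first.
- by apply/measurable_EFinP; exact: measurable_moment_weight.
- by move=> y _; rewrite lee_fin moment_weight_ge0.
- by rewrite lee_fin !mulr_ge0 ?expR_ge0.
by rewrite integral_moment_weightE// -EFinM lee_fin -(mulrA (heat_prefactor t)).
Qed.

Lemma measurable_majorant_integrand t : measurable_fun setT (majorant_integrand t).
Proof.
apply/measurable_EFinP; apply: measurable_funM.
  apply: measurable_funM => //.
  exact: (measurableT_comp (measurable_moment_weight t) measurable_snd).
apply: measurable_funM => //.
by apply: measurable_funD; exact: measurable_gauss_bump.
Qed.

Lemma measurable_heat_majorant t : 0 < t -> measurable_fun setT (heat_majorant t).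
Proof.
move=> t0; apply: emeasurable_funD.
  apply: (measurable_fun_fubini_tonelli_F (m2 := mu) (majorant_integrand t)).
  - exact: measurable_majorant_integrand.
  - by move=> u; exact: majorant_integrand_ge0.
apply/measurable_EFinP; apply: measurable_funM => //; apply: measurable_funM => //.
exact: measurable_gauss_bump.
Qed.

(** After exchanging the integrals, for fixed [y] both bumps have the same mass in [x], and only the
    weighted second moment remains. *)
Lemma integral_heat_majorant_le t : 0 < t ->
  (\int[mu]_x heat_majorant t x <= (Num.sqrt 2 ^+ n * heat_rate t)%:E)%E.
Proof.
move=> t0.
have mF : measurable_fun setT (fun x => \int[mu]_y majorant_integrand t (x, y))%E.
  apply: (measurable_fun_fubini_tonelli_F (m2 := mu) (majorant_integrand t)).
  - exact: measurable_majorant_integrand.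
  - by move=> u; exact: majorant_integrand_ge0.
have mb y : measurable_fun setT (fun x => heat_prefactor t * gauss_bump t x y).
  by apply: measurable_funM => //; exact: measurable_gauss_bump.
have b0 x y : 0 <= heat_prefactor t * gauss_bump t x y.
  by rewrite mulr_ge0 ?heat_prefactor_ge0 ?gauss_bump_ge0.
have s0 : 0 <= Num.sqrt 2 ^+ n :> R by rewrite exprn_ge0 ?sqrtr_ge0.
have c20 := time_rate_ge0 t.
rewrite ge0_integralD//; last 3 first.
- by move=> x _; apply: integral_ge0 => y _; exact: (majorant_integrand_ge0 t (x, y) t0).
- by move=> x _; rewrite lee_fin mulr_ge0.
- by apply/measurable_EFinP; apply: measurable_funM.
rewrite /heat_rate mulrDr EFinD; apply: leeD; last first.
  under eq_integral do rewrite EFinM.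
  rewrite ge0_integralZl ?integral_gauss_bump//; last 2 first.
  - exact/measurable_EFinP.
  - by move=> x _; rewrite lee_fin.
  by rewrite -EFinM lee_fin mulrC.
rewrite (fubini_tonelli (m1 := mu) (m2 := mu) (majorant_integrand t)); last 2 first.
- exact: measurable_majorant_integrand.
- by move=> u; exact: majorant_integrand_ge0.
have inner y : (\int[mu]_x majorant_integrand t (x, y) =
    (Num.sqrt 2 ^+ n * (2 * C1))%:E * (moment_weight t y)%:E)%E.
  rewrite /majorant_integrand/=.
  under eq_integral do rewrite EFinM mulrDr EFinD.
  rewrite ge0_integralZl//; last 3 first.
  - by apply: emeasurable_funD; exact/measurable_EFinP.
  - by move=> x _; rewrite adde_ge0 ?lee_fin.
  - rewrite lee_fin; apply: mulr_ge0; last exact: moment_weight_ge0.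
    by rewrite mulr_ge0// expR_ge0.
  rewrite ge0_integralD//; last 4 first.
  - by move=> x _; rewrite lee_fin.
  - exact/measurable_EFinP.
  - by move=> x _; rewrite lee_fin.
  - exact/measurable_EFinP.
  by rewrite !integral_gauss_bump// -EFinD -!EFinM; congr EFin; ring.
under eq_integral do rewrite inner.
rewrite ge0_integralZl//; last 2 first.
- by apply/measurable_EFinP; exact: measurable_moment_weight.
- by move=> y _; rewrite lee_fin moment_weight_ge0.
by rewrite integral_moment_weightE// -EFinM lee_fin -(mulrA (Num.sqrt 2 ^+ n)).
Qed.

(** * Decay of the rate and the L^p estimate *)

Lemma cvg_heat_rate : t * heat_rate t @[t --> +oo] --> 0.
Proof.
have cV : (t^-1 : R) @[t --> +oo] --> (0 : R).
  apply/gtr0_cvgV0; last exact: cvg_id.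
  exact: nbhs_pinfty_gt.
have h : 2 * C1 * (t * \int[mu]_y moment_weight t y) +
    `|M| * C2 * ts ^+ 2 * t^-1 @[t --> +oo] --> 2 * C1 * 0 + `|M| * C2 * ts ^+ 2 * 0.
  apply: cvgD; (apply: cvgM; first exact: cvg_cst) => //.
  exact: cvg_integral_moment_weight.
rewrite !mulr0 addr0 in h; apply: cvg_trans h; apply: near_eq_cvg; near=> t.
have tn0 : t != 0 by rewrite gt_eqF//; near: t; exact: nbhs_pinfty_gt.
by rewrite /heat_rate; field.
Unshelve. all: by end_near.
Qed.

Lemma heat_prefactor_le t : 0 < t -> heat_prefactor t <= t `^ (- (n%:R / 2)).
Proof.
move=> t0; rewrite /heat_prefactor powRM ?mulr_ge0 ?pi_ge0 ?(ltW t0)//.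
(* What remains is (4 pi)^(-n/2) <= 1, which follows from 4 pi >= 1. *)
rewrite ler_piMl ?powR_ge0// powRN invf_le1 ?powR_gt0 ?mulr_gt0 ?pi_gt0//.
rewrite -[leLHS](powRr0 (4 * pi)) ler_powR ?divr_ge0//.
by have := pi_ge2 R; lra.
Qed.

Lemma Lnorm_heat_error_le (t : R) (p : \bar R) : 0 < t -> `|ts / t| <= 16^-1 ->
  (1 <= p)%E ->
  ((t `^ (1 + n%:R / 2 * (1 - fine (p^-1)%E)))%:E * 'N[mu]_p
     [(fun x => (heat_solution f x t - modified_heat_kernel0 f xs ts t x)%:E)]
   <= (Num.sqrt 2 ^+ n * (t * heat_rate t))%:E)%E.
Proof.
(* Keeping the factor [Num.sqrt 2 ^+ n >= 1] in [e] lets the same [e] serve both bounds. *)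
move=> t0 tau16 p1; set e := Num.sqrt 2 ^+ n * heat_rate t.
have s1 : 1 <= Num.sqrt 2 ^+ n :> R by rewrite exprn_ege1// -[leLHS]sqrtr1 ler_wsqrtr// ler1n.
have hr0 := heat_rate_ge0 t t0.
have e0 : 0 <= e by rewrite mulr_ge0// (le_trans ler01).
have := @Lnorm_le_interpolation _ _ R mu
  (fun x => heat_solution f x t - modified_heat_kernel0 f xs ts t x)
  (heat_majorant t) (e * t `^ (- (n%:R / 2))) e p (measurable_heat_majorant t t0)
  (fun x => heat_error_le_majorant t x t0 tau16).
move=> /(_ _ _ _ e0 p1) h.
set q := fine _ in h *; set N := n%:R / 2 in h *.
apply: (@le_trans _ _ ((t `^ (1 + N * (1 - q)))%:E *
  ((e * t `^ (- N)) `^ (1 - q) * e `^ q)%:E)%E).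
  apply: lee_wpmul2l; first by rewrite lee_fin powR_ge0.
  apply: h; last by rewrite mulr_ge0// powR_ge0.
  - move=> x; apply: le_trans (heat_majorant_le t x t0) _.
    rewrite lee_fin mulrC; apply: ler_pM => //; last exact: heat_prefactor_le.
      exact: heat_prefactor_ge0.
    by rewrite ler_peMl.
  - exact: integral_heat_majorant_le.
have tn0 : t != 0 by rewrite gt_eqF.
rewrite -EFinM lee_fin (powRM (1 - q) e0 (powR_ge0 _ _)) -powRrM.
rewrite [leLHS](_ : _ = (e `^ (1 - q) * e `^ q) * (t `^ (1 + N * (1 - q)) * t `^ (- N * (1 - q)))); last by ring.
rewrite -!powRD; last 2 first.
- by rewrite tn0 implybT.
(* [e] may be 0, a case where [powRD] requires a nonzero sum of exponents; here the sum is 1. *)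
- by rewrite subrK oner_eq0.
rewrite subrK mulNr addrK !powRr1//; last exact: ltW.
by rewrite /e -mulrA (mulrC t).
Qed.

End heat_expansion.

Theorem theorem1p1 (R : realType) (n : nat) (hn : (2 <= n)%N)
    (f : Rn R n -> R) (xs : Rn R n) (c0 ts : R)
    (hf : f \in Lfun (@lebesgue_measure_n R n) 1%E)
    (hf2 : (\int[@lebesgue_measure_n R n]_x
              ((1 + enorm x) ^+ 2 * `|f x|)%:E < +oo)%E)
    (hf0 : \int[@lebesgue_measure_n R n]_x f x != 0)
    (hxs : forall i : 'I_n,
       tnth xs i * \int[@lebesgue_measure_n R n]_x f x =
       \int[@lebesgue_measure_n R n]_x (tnth x i * f x))
    (hc0 : forall i j : 'I_n,
       2^-1 * \int[@lebesgue_measure_n R n]_x (tnth x i * tnth x j * f x)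
       - 2^-1 * (\int[@lebesgue_measure_n R n]_x f x) * tnth xs i * tnth xs j
       = c0 * (i == j)%:R)
    (hts : c0 + ts * \int[@lebesgue_measure_n R n]_x f x = 0)
    (p : \bar R) (hp : (1 <= p)%E) :
  ((t `^ (1 + n%:R / 2 * (1 - fine (p^-1)%E)))%:E *
     'N[@lebesgue_measure_n R n]_p
       [(fun x => (heat_solution f x t - modified_heat_kernel0 f xs ts t x)%:E)])%E
    @[t --> +oo] --> 0%E.
Proof.
pose rate t := Num.sqrt 2 ^+ n * (t * heat_rate f xs ts t).
have rate0 : (rate t)%:E @[t --> +oo] --> 0%E.
  apply/cvg_EFin; first exact: nearW.
  rewrite -[X in _ --> X](mulr0 (Num.sqrt 2 ^+ n)).
  by apply: cvgM; [exact: cvg_cst|exact: cvg_heat_rate].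
apply: (squeeze_cvge _ (cvg_cst 0%E) rate0); near=> t.
have t0 : 0 < t by near: t; exact: nbhs_pinfty_gt.
apply/andP; split; first by rewrite mule_ge0 ?Lnorm_ge0// lee_fin powR_ge0.
apply: (Lnorm_heat_error_le f xs c0) => //.
(* The smallness of [ts / t] becomes [16 * |ts| <= t], true for large [t]; it also places [t] beyond
   [ts], where the modified kernel is meaningful. *)
rewrite normrM normfV (gtr0_norm t0) ler_pdivrMr// mulrC ler_pdivlMr; last by [].
by near: t; exact: nbhs_pinfty_ge.
Unshelve. all: by end_near.
Qed.
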